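(* Let $(X,d)$ be a locally compact metric space and let $E$ be a lattice subspace of $F(X)$ containing the constant function $\mathbf 1$ and all the functions $d_x^2$ ($x\in X$). Let $(L_n)_{n\geq 1}$ be a sequence of positive linear operators from $E$ into $F(X)$ and assume that (i) $\lim_{n\to\infty}L_n(\mathbf 1)=\mathbf 1$ uniformly on compact subsets of $X$; (ii) $\lim_{n\to\infty}L_n(d_x^2)(x)=0$ uniformly (with respect to $x$) on compact subsets of $X$. Then, for every $f\in E\cap C_b(X)$, $\lim_{n\to\infty}L_n(f)=f$ uniformly on compact subsets of $X$.
   Context: $F(X)$ is the linear space of all real-valued functions on $X$. A linear subspace $E$ of $F(X)$ is a lattice subspace if $|f|\in E$ for every $f\in E$. $C_b(X)$ is the space of all continuous bounded real-valued functions on $X$. $\mathbf 1$ is the constant function with value $1$. For $x\in X$, $d_x:X\to\mathbb R$ is $d_x(y):=d(x,y)$, and $d_x^2$ is its square. A linear operator $L:E\to F(X)$ is positive if $L(f)\geq 0$ for every $f\in E$ with $f\geq 0$ (pointwise order). *)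

(* Defs.v *)
From mathcomp Require Import all_boot all_order all_algebra.
From mathcomp Require Import all_classical all_reals all_analysis.

Set Implicit Arguments.
Unset Strict Implicit.
Unset Printing Implicit Defensive.

Import Order.TTheory GRing.Theory Num.Theory.
Import numFieldNormedType.Exports.

Local Open Scope classical_set_scope.
Local Open Scope ring_scope.

(* [F(X)] is [X -> R^o]: the regular algebra [R^o] makes it an [lmodType R]
   with pointwise operations. *)
Definition lattice_subspace (R : realType) (X : Type) (E : set (X -> R^o)) :=
  submod_closed [in E] /\ (forall f, E f -> E (fun x => `|f x|)).

Definition bounded_continuous (R : realType) (X : topologicalType) :
    set (X -> R^o) :=
  [set f | continuous f /\ bounded_fun f].

Definition sqdist (R : realType) (X : metricType R) (x : X) : X -> R^o :=
  fun y => (mdist x y) ^+ 2.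

(* An operator [E -> F(X)] is given by a total map on [F(X)] of which only the
   values on [E] matter: nothing is required outside [E]. *)
Definition linear_on (R : realType) (X : Type) (E : set (X -> R^o))
    (L : (X -> R^o) -> (X -> R^o)) :=
  forall a f g, E f -> E g -> L (a *: f + g) = a *: L f + L g.

Definition positive_on (R : realType) (X : Type) (E : set (X -> R^o))
    (L : (X -> R^o) -> (X -> R^o)) :=
  forall f, E f -> (forall x, 0 <= f x) -> forall x, 0 <= L f x.

(* Main.v *)
(* If K is compact and |f| <= M, then for every e > 0 there is C such that
   |f - f(x) 1| <= e 1 + C d_x^2 on X for all x in K: continuity gives a common
   radius r below which |f y - f x| <= e, and C = 2M/r^2 covers d(x, y) >= r.
   Applying the positive operator L_n at x yields
   |L_n f x - f x L_n 1 x| <= e L_n 1 x + C L_n (d_x^2) x, which is uniformly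
   small on K by (i) and (ii). *)

Require Import Defs.
From mathcomp Require Import all_boot all_order all_algebra.
From mathcomp Require Import all_classical all_reals all_analysis.
From mathcomp Require Import ring lra.
Set Implicit Arguments.
Unset Strict Implicit.
Unset Printing Implicit Defensive.

Import Order.TTheory GRing.Theory Num.Theory.
Import numFieldNormedType.Exports.
Local Open Scope classical_set_scope.
Local Open Scope ring_scope.

(** Holds because the sets of pairs at distance [< e] form a base of the entourages of [R^o]. *)
Lemma uniform_cvgrPdist_lt (R : realType) (T : choiceType) (A : set T)
    (u : nat -> T -> R^o) (f : T -> R^o) :
  {uniform A, u @ \oo --> f} <->
  forall e : R, 0 < e -> \forall n \near \oo, forall x, A x -> `|f x - u n x| < e.
Proof.
split=> [uf e e0 | uf P /uniform_nbhs[V [+ VP]]].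
  apply: (uf [set h | forall x, A x -> `|f x - h x| < e]).
  apply/uniform_nbhs; exists [set xy : R^o * R^o | ball xy.1 e xy.2].
  by split=> //; rewrite -entourage_ballE; exists e.
rewrite -entourage_ballE => -[e /= e0 eV].
near=> n; apply: VP => x Ax; apply: eV => /=.
by move: x Ax; near: n; exact: uf.
Unshelve. all: by end_near. Qed.

(** Only [x] is confined to [K], while [y] ranges over all of [X]. The near-covering form of
    compactness reduces the common radius to a local claim: [P r x'] for [x'] near [x] and [r] near
    [0^'+] jointly. *)
Lemma compact_continuous_uniform (R : realType) (X : metricType R) (K : set X)
    (f : X -> R^o) (e : R) :
  compact K -> continuous f -> 0 < e ->
  exists2 r : R, 0 < r &
    forall x y, K x -> mdist x y < r -> `|f y - f x| < e.
Proof.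
move=> /compact_near_coveringP cK cf e0.
have e20 : 0 < e / 2 by rewrite divr_gt0.
pose P (r : R) (x : X) := forall y, mdist x y < r -> `|f y - f x| < e.
suff KP : \forall r \near 0^'+, K `<=` P r.
  have [r [r0 Pr]] : exists r : R, 0 < r /\ K `<=` P r.
    by apply: (@filter_ex _ (0 : R)^'+); near=> r; split=> //; near: r.
  by exists r => // x y /Pr; exact.
apply: cK => x Kx; have /cvgrPdist_lt/(_ _ e20) : f z @[z --> x] --> f x := cf x.
move=> /metricType_numDomainType.nbhs_mdistP[d /= d0 dP].
have d20 : 0 < d / 2 by rewrite divr_gt0.
(* With both radii at most [d / 2], the triangle inequality keeps [x'] and [y] within [d] of [x], so
   both values lie within [e / 2] of [f x]. *)
exists ([set x' | mdist x x' < d / 2], [set r | r < d / 2]) => /=.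
  split; last exact: nbhs_right_lt.
  by apply/metricType_numDomainType.nbhs_mdistP; exists (d / 2).
move=> [x' r] /= [xx' rd] y x'y.
have fx' : `|f x - f x'| < e / 2 by apply: dP => /=; lra.
have fy : `|f x - f y| < e / 2.
  by apply: dP => /=; have := metric_triangle x x' y; lra.
rewrite (_ : f y - f x' = (f x - f x') - (f x - f y)); last by ring.
by rewrite (le_lt_trans (ler_normB _ _))//; lra.
Unshelve. all: by end_near. Qed.

Section positive_operators.
Context (R : realType) (X : Type) (E : set (X -> R^o)).
Variable L : (X -> R^o) -> (X -> R^o).
Hypotheses (sE : submod_closed [in E]) (linL : linear_on E L).

Lemma submod_closed_lin (a : R) f g : E f -> E g -> E (a *: f + g).
Proof.
by case: sE => _ clE Ef Eg; apply/set_mem/clE; exact: mem_set.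
Qed.

Lemma submod_closed_zero : E 0.
Proof. by case: sE => /set_mem. Qed.

Lemma submod_closed_scale (a : R) f : E f -> E (a *: f).
Proof.
move=> Ef; rewrite -[_ *: _]addr0.
exact: submod_closed_lin submod_closed_zero.
Qed.

Lemma linear_on_scale (a : R) f : E f -> L (a *: f) = a *: L f.
Proof.
move=> Ef; have E0 := submod_closed_zero.
(* Linearity is stated only for [a *: f + g]; taking [a = -1] and [f = g = 0] gives
   [L 0 = - L 0 + L 0]. *)
have L0 : L 0 = 0.
  by have := linL (- 1) E0 E0; rewrite scaler0 addr0 scaleN1r addNr.
by rewrite -[a *: f]addr0 linL// L0 addr0.
Qed.

(** The bound on [f] says that [s *: f + g] is nonnegative for [s = 1] and [s = -1]; positivity of
    [L] on these two functions gives the two halves of the conclusion. *)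
Lemma positive_on_norm_le (f g : X -> R^o) : positive_on E L -> E f -> E g ->
  (forall y, `|f y| <= g y) -> forall x, `|L f x| <= L g x.
Proof.
move=> posL Ef Eg fg x.
have h (s : R) : (forall y, 0 <= s * f y + g y) -> 0 <= s * L f x + L g x.
  move=> s0; have := posL _ (submod_closed_lin s Ef Eg) s0 x.
  by rewrite linL.
rewrite ler_norml; apply/andP; split.
  have : 0 <= 1 * L f x + L g x; last by lra.
  by apply: h => y; have := fg y; rewrite ler_norml => /andP[]; lra.
have : 0 <= - 1 * L f x + L g x; last by lra.
by apply: h => y; have := fg y; rewrite ler_norml => /andP[]; lra.
Qed.

End positive_operators.

(** With [x] fixed, [f x] is a scalar, so [f - f x *: cst 1] and its majorant both lie in [E]; the
    operator inequality is then evaluated at this same [x]. *)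
Lemma positive_on_sqdist_le (R : realType) (X : metricType R)
    (E : set (X -> R^o)) (L : (X -> R^o) -> (X -> R^o)) (f : X -> R^o)
    (x : X) (e C : R) :
  submod_closed [in E] -> linear_on E L -> positive_on E L ->
  E (cst 1) -> E (sqdist x) -> E f ->
  (forall y, `|f y - f x| <= e + C * sqdist x y) ->
  `|L f x - f x * L (cst 1) x| <= e * L (cst 1) x + C * L (sqdist x) x.
Proof.
move=> sE linL posL E1 Ed Ef fC.
have Eg : E (C *: sqdist x + e *: cst 1).
  by apply: submod_closed_lin => //; exact: submod_closed_scale.
have Eh := submod_closed_lin sE (- f x) E1 Ef.
have fg y : `|((- f x) *: cst 1 + f : X -> R^o) y|
    <= (C *: sqdist x + e *: cst 1 : X -> R^o) y.
  rewrite (_ : ((- f x) *: cst 1 + f : X -> R^o) y = f y - f x).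
    rewrite (_ : (C *: sqdist x + e *: cst 1 : X -> R^o) y
                 = e + C * sqdist x y)//.
    by rewrite /= !fctE /GRing.scale /=; ring.
  by rewrite !fctE /GRing.scale /=; ring.
have := positive_on_norm_le sE linL posL Eh Eg fg x.
rewrite !linL//; last exact: submod_closed_scale.
rewrite (linear_on_scale sE linL)//.
rewrite !fctE /GRing.scale /= (addrC (- f x * _)) mulNr.
by rewrite [X in _ <= X -> _]addrC.
Qed.

Theorem theorem3p5 (R : realType) (X : metricType R)
    (lcX : locally_compact [set: X])
    (E : set (X -> R^o)) (latE : lattice_subspace E)
    (E1 : E (cst 1)) (Ed : forall x : X, E (sqdist x))
    (L : nat -> (X -> R^o) -> (X -> R^o))
    (linL : forall n, (1 <= n)%N -> linear_on E (L n))
    (posL : forall n, (1 <= n)%N -> positive_on E (L n))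
    (L1 : {family compact, (fun n => L n (cst 1)) @ \oo --> (cst 1 : X -> R^o)})
    (Ld : {family compact,
             (fun n (x : X) => L n (sqdist x) x) @ \oo --> (cst 0 : X -> R^o)}) :
  forall f : X -> R^o, (E `&` @bounded_continuous R X) f ->
    {family compact, (fun n => L n f) @ \oo --> f}.
Proof.
move=> f [Ef [cf /ex_strict_bound_gt0[M M0 fM]]].
have [sE _] := latE.
apply/fam_cvgP => K cK; apply/uniform_cvgrPdist_lt => e e0.
have e40 : 0 < e / 4 by rewrite divr_gt0.
have [r r0 fr] := compact_continuous_uniform cK cf e40.
have [C C0 fC] : exists2 C : R, 0 < C &
    forall x y, K x -> `|f y - f x| <= e / 4 + C * sqdist x y.
  have C0 : 0 < 2 * M / r ^+ 2 by rewrite divr_gt0 ?mulr_gt0 ?exprn_gt0.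
  exists (2 * M / r ^+ 2) => // x y Kx.
  have [xyr|rxy] := ltP (mdist x y) r.
    by rewrite (le_trans (ltW (fr _ _ Kx xyr)))// lerDl mulr_ge0 ?sqr_ge0// ltW.
  have : 2 * M <= 2 * M / r ^+ 2 * sqdist x y.
    rewrite -[leLHS](@divfK _ (r ^+ 2)) ?gt_eqF ?exprn_gt0//.
    by rewrite ler_wpM2l ?(ltW C0)// lerXn2r ?nnegrE ?mdist_ge0// ltW.
  have := ler_normB (f y) (f x); have := fM x I; have := fM y I => /=; lra.
move/(@fam_cvgP _ R^o)/(_ _ cK)/uniform_cvgrPdist_lt : L1 => L1.
move/(@fam_cvgP _ R^o)/(_ _ cK)/uniform_cvgrPdist_lt : Ld => Ld.
(* The bound 1 will give [L n (cst 1) x < 2], and [e / (4 * M)] will make [M * |1 - L n (cst 1) x|]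
   less than [e / 4]. *)
have m0 : 0 < Num.min 1 (e / (4 * M)) by rewrite lt_min ltr01 divr_gt0 ?mulr_gt0.
have c0 : 0 < e / (4 * C) by rewrite divr_gt0 ?mulr_gt0.
near=> n => x Kx.
(* Linearity and positivity are assumed from index 1 on, so the index 0 is discarded. *)
have n0 : (1 <= n)%N by near: n; exact: nbhs_infty_ge.
have := positive_on_sqdist_le sE (linL n n0) (posL n n0) E1 (Ed x) Ef
  (fun y => fC x y Kx).
have : `|1 - L n (cst 1) x| < Num.min 1 (e / (4 * M)).
  by move: x Kx; near: n; exact: L1.
have : `|0 - L n (sqdist x) x| < e / (4 * C).
  by move: x Kx; near: n; exact: Ld.
rewrite sub0r normrN.
set ld : R := L n _ x; set l1 : R := L n _ x; set lf : R := L n f x.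
move=> /(le_lt_trans (ler_norm _)); rewrite ltr_pdivlMr ?mulr_gt0// => ldC.
rewrite lt_min ltr_pdivlMr ?mulr_gt0// => /andP[l1_1 l1M] lfC.
have l1_2 : l1 < 2 by move: l1_1; rewrite ltr_distlC => /andP[_]; lra.
have fl : `|f x * (1 - l1)| <= M * `|1 - l1|.
  by rewrite normrM ler_wpM2r// ltW// fM.
have el : e / 4 * l1 < e / 4 * 2 by rewrite ltr_pM2l.
(* The first term is below [e / 4]; the second is at most [e / 4 * l1 + C * ld], which is below
   [e / 2 + e / 4]. The total is below [e]. *)
rewrite (_ : f x - lf = f x * (1 - l1) - (lf - f x * l1)); last by ring.
by rewrite (le_lt_trans (ler_normB _ _))//; lra.
Unshelve. all: by end_near. Qed.
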